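(* Let $d>1$. On coordinate structures of $(d-1)$-pictures, $\mathrm{ESO}(\forall^d,\mathrm{arity}\ d)=\mathrm{ESO}(\forall^d,\mathrm{arity}\ d,\mathrm{sorted})$: for every finite alphabet $\Sigma$ and every sentence $\Phi\in\mathrm{ESO}(\forall^d,\mathrm{arity}\ d)$ over the signature of coordinate structures of $(d-1)$-pictures over $\Sigma$, there is a sentence $\Phi'\in\mathrm{ESO}(\forall^d,\mathrm{arity}\ d,\mathrm{sorted})$ such that for every $(d-1)$-picture $p$ over $\Sigma$, $\mathrm{coord}^{d-1}(p)\models\Phi$ iff $\mathrm{coord}^{d-1}(p)\models\Phi'$ (and conversely every sorted sentence is already in $\mathrm{ESO}(\forall^d,\mathrm{arity}\ d)$).
   Context: For $n\ge1$ let $[n]=\{1,\dots,n\}$. A $k$-picture over $\Sigma$ is $p:[n]^k\to\Sigma$. Its coordinate structure $\mathrm{coord}^k(p)$ has domain $[n]$, $k$-ary relations $Q_s=\{a\in[n]^k:p(a)=s\}$ ($s\in\Sigma$), the usual order $<$, $\min=\{1\}$, $\max=\{n\}$, and the unary function $\mathrm{succ}$ with $\mathrm{succ}(i)=i+1$ for $i<n$, $\mathrm{succ}(n)=1$. $\mathrm{ESO}(\forall^d,\mathrm{arity}\ \ell)$: sentences $\exists R_1\dots\exists R_m\,\forall x_1\dots\forall x_d\,\theta$, $R_j$ relation symbols of arity at most $\ell$, $\theta$ quantifier-free. $\mathrm{ESO}(\forall^d,\mathrm{arity}\ d,\mathrm{sorted})$ (for coordinate structures of $k$-pictures, $k\le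 d$): sentences $\exists\mathbf R\,\forall\mathbf x\,\psi(\mathbf x)$ where $\mathbf R$ is a list of relation symbols of arity exactly $d$, $\mathbf x=(x_1,\dots,x_d)$, $\psi$ is quantifier-free and each atom of $\psi$ has one of the forms: (i) $Q_s(x_1,\dots,x_k)$ with $s\in\Sigma$; (ii) $R(\mathbf x)$ or $R(\mathbf x^{(i)})$ with $R\in\mathbf R$, $i\in[d]$, where $\mathbf x^{(i)}$ is $\mathbf x$ with $x_i$ replaced by $\mathrm{succ}(x_i)$; (iii) $\min(x_i)$ or $\max(x_i)$, $i\in[d]$. (In particular no equality or $<$ atoms occur.) *)

(* Defs.v *)
From HB Require Import structures.
From mathcomp Require Import all_boot.

Set Implicit Arguments.
Unset Strict Implicit.
Unset Printing Implicit Defensive.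

(** The side [{1, ..., n}] is represented by ['I_n], i.e. shifted by one. *)
Definition picture (Sigma : finType) (k n : nat) := k.-tuple 'I_n -> Sigma.

Record structure (Sigma : finType) (k : nat) := Structure {
  dom :> finType;
  letter : Sigma -> pred (k.-tuple dom);
  lt_rel : rel dom;
  min_pred : pred dom;
  max_pred : pred dom;
  succ_fun : dom -> dom
}.

(** [ordS] is the cyclic successor: it sends the last element to the first. *)
Definition coord (Sigma : finType) (k n : nat) (p : picture Sigma k n) :
    structure Sigma k :=
  {| dom := 'I_n;
     letter := fun s a => p a == s;
     lt_rel := fun i j => i < j;
     min_pred := fun i => i == 0 :> nat;
     max_pred := fun i => i == n.-1 :> nat;
     succ_fun := @ordS n |}.

Inductive term (d : nat) :=
  | Var of 'I_d
  | Succ of term d.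

Inductive atom (Sigma : finType) (k d : nat) (rels : finType)
    (ar : rels -> nat) :=
  | ALetter of Sigma & k.-tuple (term d)
  | ARel (r : rels) of (ar r).-tuple (term d)
  | AEq of term d & term d
  | ALt of term d & term d
  | AMin of term d
  | AMax of term d.

Inductive qf_formula (Sigma : finType) (k d : nat) (rels : finType)
    (ar : rels -> nat) :=
  | FAtom of atom Sigma k d ar
  | FNot of qf_formula Sigma k d ar
  | FAnd of qf_formula Sigma k d ar & qf_formula Sigma k d ar
  | FOr of qf_formula Sigma k d ar & qf_formula Sigma k d ar.

(** A sentence [exists R_1 ... R_m, forall x_1 ... x_d, theta]; the type [rels]
    is the finite set of the quantified relation symbols. *)
Record eso_sentence (Sigma : finType) (k d : nat) := EsoSentence {
  rels : finType;
  arity : rels -> nat;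
  matrix : qf_formula Sigma k d arity
}.

Section Semantics.
Variables (Sigma : finType) (k d : nat) (M : structure Sigma k).
Variable v : 'I_d -> M.

Fixpoint eval_term (t : term d) : M :=
  match t with
  | Var i => v i
  | Succ u => succ_fun (eval_term u)
  end.

Variables (rels : finType) (ar : rels -> nat).
Variable I : forall r : rels, pred ((ar r).-tuple M).

Definition eval_atom (a : atom Sigma k d ar) : bool :=
  match a with
  | ALetter s t => letter s (map_tuple eval_term t)
  | ARel r t => I (map_tuple eval_term t)
  | AEq t u => eval_term t == eval_term u
  | ALt t u => lt_rel (eval_term t) (eval_term u)
  | AMin t => min_pred (eval_term t)
  | AMax t => max_pred (eval_term t)
  end.

Fixpoint eval_qf (f : qf_formula Sigma k d ar) : bool :=
  match f with
  | FAtom a => eval_atom a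
  | FNot g => ~~ eval_qf g
  | FAnd g h => eval_qf g && eval_qf h
  | FOr g h => eval_qf g || eval_qf h
  end.

End Semantics.

Definition models (Sigma : finType) (k d : nat) (M : structure Sigma k)
    (Phi : eso_sentence Sigma k d) : Prop :=
  exists I : forall r : rels Phi, pred ((arity r).-tuple M),
  forall v : 'I_d -> M, eval_qf v I (matrix Phi).

(** Membership in ESO(forall^d, arity l); [d] is a parameter of the type. *)
Definition in_ESO (Sigma : finType) (k d : nat) (l : nat)
    (Phi : eso_sentence Sigma k d) : Prop :=
  forall r : rels Phi, arity r <= l.

Definition xvars (d : nat) : seq (term d) := [seq Var j | j <- enum 'I_d].

Definition xvars_succ (d : nat) (i : 'I_d) : seq (term d) :=
  [seq if j == i then Succ (Var j) else Var j | j <- enum 'I_d].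

(** Argument tuples are compared as sequences, which avoids casts between
    tuples of lengths [ar r] and [d]. *)
Definition sorted_atom (Sigma : finType) (k d : nat) (rels : finType)
    (ar : rels -> nat) (a : atom Sigma k d ar) : Prop :=
  match a with
  | ALetter _ t => tval t = take k (xvars d)
  | ARel _ t => tval t = xvars d \/ exists i : 'I_d, tval t = xvars_succ i
  | AMin t | AMax t => exists i : 'I_d, t = Var i
  | AEq _ _ | ALt _ _ => False
  end.

Fixpoint sorted_qf (Sigma : finType) (k d : nat) (rels : finType)
    (ar : rels -> nat) (f : qf_formula Sigma k d ar) : Prop :=
  match f with
  | FAtom a => sorted_atom a
  | FNot g => sorted_qf g
  | FAnd g h | FOr g h => sorted_qf g /\ sorted_qf h
  end.

Definition in_ESO_sorted (Sigma : finType) (k d : nat)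
    (Phi : eso_sentence Sigma k d) : Prop :=
  (forall r : rels Phi, arity r = d) /\ sorted_qf (matrix Phi).

(* Main.v *)
(** A sorted sentence asks for a labelling of the grid [n]^d obeying a constraint
    between neighbouring points.  The label of a point [x] is meant to record,
    for every relation [R] and every selection [h] of coordinates (or of the
    minimum), whether [R] holds of [x o h]; then the matrix of the given sentence
    becomes a condition on a single label.  What has to be enforced locally is
    that two pairs [(x, h)] and [(y, h')] with [x o h = y o h'] carry the same
    bit.  If [h] misses a coordinate, the missed coordinate is free and serves as
    a buffer to move the values of [x] to their places in [y], one unit step at a
    time.  If [h] is onto, no such transport exists, and only points [x] with
    increasing coordinates are used: these are determined by [x o h].  A letter
    has [d - 1] arguments, hence always leaves a free coordinate, and so does a
    successor that wraps around, as its value is then the minimum. *)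

Require Import Defs.
From mathcomp Require Import all_boot zify.

Set Implicit Arguments.
Unset Strict Implicit.
Unset Printing Implicit Defensive.

(** * Points of the grid *)

Section Points.
Variables d n : nat.
Implicit Types (x y a : {ffun 'I_d -> 'I_n.+1}).
Implicit Types (h : {ffun 'I_d -> option 'I_d}).

Definition slot_val x (o : option 'I_d) : 'I_n.+1 :=
  if o is Some j then x j else ord0.

(** The composite [x o h], with [None] standing for the minimum. *)
Definition pull x h : {ffun 'I_d -> 'I_n.+1} := [ffun i => slot_val x (h i)].

Definition set_at x j c : {ffun 'I_d -> 'I_n.+1} :=
  [ffun k => if k == j then c else x k].

Definition step x j := set_at x j (ordS (x j)).

Definition monotone x := [forall i : 'I_d, forall j : 'I_d, (i <= j) ==> (x i <= x j)].

Definition onto_slots h := [forall j : 'I_d, Some j \in codom h].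

(** Once [u] holds a copy of the value at [j], reading [u] instead frees the coordinate [j]. *)
Definition redirect h (j u : 'I_d) : {ffun 'I_d -> option 'I_d} :=
  [ffun i => if h i == Some j then Some u else h i].

Lemma monotoneP x : reflect (forall i j : 'I_d, i <= j -> x i <= x j) (monotone x).
Proof.
apply: (iffP forallP) => [mx i j le_ij | mx i].
  by move/forallP: (mx i) => /(_ j); rewrite le_ij.
by apply/forallP=> j; apply/implyP; apply: mx.
Qed.

Lemma missed_slotP h : reflect (exists j, Some j \notin codom h) (~~ onto_slots h).
Proof. by rewrite negb_forall; apply: existsP. Qed.

Lemma pull_set_at x h j c :
  Some j \notin codom h -> pull (set_at x j c) h = pull x h.
Proof.
move=> hj; apply/ffunP=> i; rewrite !ffunE /slot_val.
case E: (h i) => [k|] //; rewrite ffunE; case: eqP => // kj.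
by case/negP: hj; rewrite -kj -E codom_f.
Qed.

Lemma pull_redirect x h j u : x u = x j -> pull x (redirect h j u) = pull x h.
Proof. by move=> xuj; apply/ffunP=> i; rewrite !ffunE; case: eqP => [->|]. Qed.

Lemma redirect_missed h j u : j != u -> Some j \notin codom (redirect h j u).
Proof.
move=> ju; apply/codomP=> -[i]; rewrite ffunE; case: eqP => [_ [] /eqP|hij hji].
  by rewrite (negPf ju).
exact: hij.
Qed.

Lemma val_iter_ordS (i : 'I_n.+1) m : iter m (@ordS n.+1) i = (i + m) %% n.+1 :> nat.
Proof.
elim: m => [|m IH] /=; first by rewrite addn0 modn_small.
by rewrite IH -addn1 modnDml addn1 addnS.
Qed.

Lemma ordS_reach (i c : 'I_n.+1) : exists m, iter m (@ordS n.+1) i = c.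
Proof.
(* First wrap around from [i] to the minimum, then climb to [c]. *)
exists (c + (n.+1 - i)); apply: ord_inj; rewrite val_iter_ordS.
have -> : i + (c + (n.+1 - i)) = c + n.+1 by have := ltn_ord i; lia.
by rewrite modnDr modn_small.
Qed.

Lemma ordS_small (i : 'I_n.+1) : i != n :> nat -> ordS i = i.+1 :> nat.
Proof. by move=> i_n /=; rewrite modn_small //; have := ltn_ord i; lia. Qed.

Lemma ordS_max (i : 'I_n.+1) : i = n :> nat -> ordS i = ord0.
Proof. by move=> i_n; apply: val_inj; rewrite /= i_n modnn. Qed.

Lemma ordS_eq0 (i : 'I_n.+1) : (ordS i == ord0) = (i == n :> nat).
Proof.
case: (eqVneq (i : nat) n) => [/ordS_max -> // | i_n].
by apply/negbTE; rewrite -val_eqE -[val _]/(nat_of_ord _) ordS_small.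
Qed.

(* The coordinates of [a] are listed in increasing order, [i] coming last among
   the coordinates of equal value, so that incrementing it keeps the order. *)
Lemma sort_point a i :
  exists x (s : {ffun 'I_d -> 'I_d}),
    [/\ injective s, a = [ffun k => x (s k)], monotone x &
        a i != n :> nat -> monotone (step x (s i))].
Proof.
(* Doubling leaves the last bit free to break ties, without disturbing distinct values. *)
pose key k := 2 * a k + (k == i).
pose r := sort (relpre key leq) (enum 'I_d).
have r_perm : perm_eq r (enum 'I_d) by rewrite perm_sort.
have r_size : size r = d by rewrite (perm_size r_perm) size_enum_ord.
have r_uniq : uniq r by rewrite (perm_uniq r_perm) enum_uniq.
have r_mem k : k \in r by rewrite (perm_mem r_perm) mem_enum.
have idx k : index k r < d by rewrite -{2}r_size index_mem.
(* [s k] is the rank of coordinate [k] in the sorted list [r]. *)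
pose s := [ffun k => Ordinal (idx k)].
pose x := [ffun j : 'I_d => a (nth j r j)].
have nth_key (j l : 'I_d) : j <= l -> key (nth j r j) <= key (nth l r l).
  move=> jl; rewrite (set_nth_default j l) ?r_size //.
  have r_sorted : sorted (relpre key leq) r.
    by apply: sort_sorted => u v; apply: leq_total.
  apply: (sorted_leq_nth _ _ j r_sorted) => //; rewrite ?inE ?r_size //.
    by move=> u v w; apply: leq_trans.
  by move=> u; apply: leqnn.
have nth_s k : nth (s k) r (s k) = k by rewrite ffunE nth_index.
have s_nth (j : 'I_d) : s (nth j r j) = j.
  by apply: val_inj; rewrite ffunE /= index_uniq ?r_size.
exists x, s; split.
- by move=> k l kl; rewrite -(nth_s k) kl nth_s.
- by apply/ffunP=> k; rewrite ffunE [RHS]ffunE nth_s.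
- apply/monotoneP=> j l /nth_key; rewrite /key !ffunE; lia.
- move=> ai; apply/monotoneP=> j l jl; move: (nth_key j l jl); rewrite /key.
  have eqi (q : 'I_d) : (q == s i) = (nth q r q == i).
    by apply/eqP/eqP=> [-> | <-]; rewrite ?nth_s ?s_nth.
  have xE (q : 'I_d) : step x (s i) q = x q + (q == s i) :> nat.
    rewrite ffunE; case: eqP => [-> | _]; last by rewrite addn0.
    by rewrite addn1 ordS_small // [x _]ffunE nth_s.
  have [-> //|jl'] := eqVneq j l.
  rewrite !xE !eqi !ffunE.
  (* At most one of the two positions is incremented. If it is the lower one, [2 * u + 1 <= 2 * w]
     gives [u + 1 <= w]. *)
  have : ~~ ((nth j r j == i) && (nth l r l == i)).
    by rewrite -!eqi; apply: contraNN jl' => /andP[/eqP-> /eqP->].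
  by case: (nth j r j == i); case: (nth l r l == i) => //= _; lia.
Qed.

End Points.

(** * Consistency of the labels *)

Section Folding.
Variables d n : nat.
Implicit Types (x y a : {ffun 'I_d -> 'I_n.+1}).
Implicit Types (h : {ffun 'I_d -> option 'I_d}).

(** [F h x] is the bit stored at [x] for the selection [h], one symbol and one shift being fixed.
    The hypotheses are what the local constraints provide. *)
Variable F : {ffun 'I_d -> option 'I_d} -> {ffun 'I_d -> 'I_n.+1} -> bool.
Hypothesis F_pull : forall x h h', pull x h = pull x h' -> F h x = F h' x.
Hypothesis F_step : forall x h j, Some j \notin codom h -> F h (step x j) = F h x.

Lemma F_set_at x h j c : Some j \notin codom h -> F h (set_at x j c) = F h x.
Proof.
move=> hj; have [m <- {c}] := ordS_reach (x j) c.
elim: m => [|m IH].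
  by congr (F h _); apply/ffunP=> k; rewrite ffunE; case: eqP => [->|].
rewrite -IH -[RHS](F_step _ hj); congr (F h _); apply/ffunP=> k.
by rewrite /step !ffunE eqxx; case: eqP.
Qed.

Lemma F_agree x y h : (forall j, Some j \in codom h -> x j = y j) -> F h x = F h y.
Proof.
move=> xy.
have agree_on (s : seq 'I_d) : F h [ffun k => if k \in s then y k else x k] = F h x.
  elim: s => [|j s IH].
    by congr (F h _); apply/ffunP=> k; rewrite ffunE.
  rewrite -IH; have [hj|hj] := boolP (Some j \in codom h).
    congr (F h _); apply/ffunP=> k; rewrite !ffunE inE.
    by case: eqP => [->|] //=; rewrite xy //; case: ifP.
  rewrite -[RHS](F_set_at _ (y j) hj); congr (F h _); apply/ffunP=> k.
  by rewrite !ffunE inE; case: eqP => [->|].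
by rewrite -(agree_on (enum 'I_d)); congr (F h _); apply/ffunP=> k;
   rewrite ffunE mem_enum.
Qed.

(** A normal form for selections reading [a] from [x]: each non-minimal value uses a single
    coordinate, and the minimum uses none. *)
Definition canonical_slots x a : {ffun 'I_d -> option 'I_d} :=
  [ffun i => if a i == ord0 then None else [pick j | x j == a i]].

Lemma pull_canonical x h : pull x (canonical_slots x (pull x h)) = pull x h.
Proof.
apply/ffunP=> i; rewrite !ffunE; case: (eqVneq (slot_val x (h i))) => [->|] //.
case: pickP => [j /eqP //|none]; case: (h i) none => [j|] //= none.
by move: (none j); rewrite eqxx.
Qed.

Lemma mem_canonical x a j :
  Some j \in codom (canonical_slots x a) ->
  exists i, [/\ canonical_slots x a i = Some j, x j = a i & a i != ord0].
Proof.
case/codomP=> i E; exists i; move: (E); rewrite ffunE.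
case: (eqVneq (a i)) => // ai; case: pickP => // k /eqP xk [jk].
by split; rewrite // jk.
Qed.

Lemma canonical_inj x a j k :
  Some j \in codom (canonical_slots x a) ->
  Some k \in codom (canonical_slots x a) -> x j = x k -> j = k.
Proof.
case/mem_canonical=> i [Ei xj _] /mem_canonical[l [El xk _]] xjk.
apply: Some_inj; rewrite -Ei -El !ffunE.
by rewrite -xj -xk xjk.
Qed.

(** The buffer [w] must not hold a value already in its final place. If the missed [u] does, [h]
    reads the same value at another coordinate [w]. Redirecting [w] to [u] frees [w], which is not
    in place too because canonical slots are injective. *)
Lemma loose_missed_slot x y a h :
  pull x h = a -> ~~ onto_slots h ->
  exists h' w, [/\ pull x h' = a, Some w \notin codom h' &
    (Some w \in codom (canonical_slots y a)) ==> (x w != y w)].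
Proof.
move=> xa /missed_slotP[u hu].
have [hcu|hcu] := boolP ((Some u \in codom (canonical_slots y a)) ==> (x u != y u)).
  by exists h, u.
move: hcu; rewrite negb_imply negbK => /andP[cu /eqP xyu].
have [i [_ yu ai]] := mem_canonical cu.
case hi: (h i) => [w|]; last first.
  by move: ai; rewrite -xa ffunE hi eqxx.
have xw : x w = x u by rewrite xyu yu -xa ffunE hi.
have wu : w != u by apply: contraNneq hu => <-; rewrite -hi codom_f.
exists (redirect h w u), w; rewrite pull_redirect // redirect_missed //.
split=> //; apply/implyP=> cw; apply: contraNneq wu => xyw.
by apply/eqP/(canonical_inj cw cu); rewrite -xyw xw.
Qed.

(* A sliding puzzle: as some coordinate of [x] is not used by [h], it serves as
   a buffer through which the used values are moved one by one to the
   coordinates where [y] has them. *)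
Lemma F_missed_slot x h y h' :
  pull x h = pull y h' -> ~~ onto_slots h -> F h x = F h' y.
Proof.
set a := pull y h' => xa h_miss.
have ca : pull y (canonical_slots y a) = a by apply: pull_canonical.
rewrite -(F_pull ca).
set c := canonical_slots y a in ca *.
(* Induction on the number of target coordinates not yet holding their final value. *)
pose bad x := [set j | (Some j \in codom c) && (x j != y j)].
have [N] := ubnP #|bad x|; elim: N => // N IH in x h xa h_miss *; rewrite ltnS => badN.
have [bad0|[j jbad]] := set_0Vmem (bad x).
  have xy j : Some j \in codom c -> x j = y j.
    move=> cj; apply/eqP; apply: contraT => xyj.
    by move: (in_set0 j); rewrite -bad0 inE cj xyj.
  rewrite -(F_agree xy); apply: F_pull; rewrite xa -ca; apply/ffunP=> i.
  by rewrite [LHS]ffunE [RHS]ffunE /slot_val; case E: (c i) => [k|] //; rewrite xy // -E codom_f.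
have [h1 [w [xa1 h1w cw]]] := loose_missed_slot y xa h_miss.
have -> : F h x = F h1 x by apply: F_pull; rewrite xa xa1.
(* If the buffer is itself a target, it receives its final value at once. *)
have [cw'|cw'] := boolP (Some w \in codom c).
  rewrite -(F_set_at _ (y w) h1w); apply: IH.
  - by rewrite pull_set_at.
  - by apply/missed_slotP; exists w.
  apply: leq_trans badN; apply: proper_card; apply/properP; split.
    apply/subsetP=> k; rewrite !inE ffunE; have [->|//] := eqVneq k w.
    by rewrite eqxx andbF.
  by exists w; rewrite !inE ?ffunE ?eqxx ?andbF // cw' (implyP cw).
(* Otherwise the value at a bad [j] is saved in the buffer, and [j] receives its final value. *)
move: (jbad); rewrite inE => /andP[cj xyj].
have jw : j != w by apply: contraNneq cw' => <-.
rewrite -(F_set_at _ (x j) h1w).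
set x1 := set_at x w (x j).
have x1jw : x1 w = x1 j by rewrite !ffunE eqxx (negPf jw).
have -> : F h1 x1 = F (redirect h1 j w) x1 by apply: F_pull; rewrite pull_redirect.
have hj := redirect_missed h1 jw.
rewrite -(F_set_at _ (y j) hj); apply: IH.
- by rewrite pull_set_at // pull_redirect // pull_set_at.
- by apply/missed_slotP; exists j.
apply: leq_trans badN; apply: proper_card; apply/properP; split.
  apply/subsetP=> k; rewrite !inE 2!ffunE; have [->|_] := eqVneq k j.
    by rewrite eqxx andbF.
  by have [->|//] := eqVneq k w; rewrite (negPf cw').
by exists j; rewrite // !inE ffunE !eqxx andbF.
Qed.

Definition usable x h := monotone x || ~~ onto_slots h.

(** By counting, [d] slots that hit all [d] coordinates hit each exactly once and are never
    [None]. *)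
Lemma perm_codom_pull x h : onto_slots h -> perm_eq (codom (pull x h)) (codom x).
Proof.
move=> /forallP h_onto.
have hE : perm_eq (codom h) [seq Some j | j <- enum 'I_d].
  have u : uniq [seq Some j | j <- enum 'I_d].
    by rewrite map_inj_uniq ?enum_uniq // => ? ? [].
  have sub : {subset [seq Some j | j <- enum 'I_d] <= codom h}.
    by move=> _ /mapP[j _ ->].
  have le : size (codom h) <= size [seq Some j | j <- enum 'I_d].
    by rewrite size_codom size_map -cardE.
  rewrite perm_sym; apply: uniq_perm => //; first exact: leq_size_uniq le.
  exact: (uniq_min_size u sub le).2.
have -> : codom (pull x h) = map (slot_val x) (codom h).
  by rewrite /codom /image_mem -map_comp; apply: eq_map => i; rewrite ffunE.
have -> : codom x = map (slot_val x) [seq Some j | j <- enum 'I_d].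
  by rewrite -map_comp.
exact: perm_map.
Qed.

Lemma monotone_codom_inj x y :
  monotone x -> monotone y -> perm_eq (codom x) (codom y) -> x = y.
Proof.
have mono_sorted z : monotone z -> sorted leq (map val (codom z)).
  move=> /monotoneP mz; rewrite -map_comp sorted_map.
  apply: (@sub_sorted _ (relpre val leq)) => [i j|]; first exact: mz.
  by rewrite -sorted_map val_enum_ord iota_sorted.
move=> /mono_sorted sx /mono_sorted sy /(perm_map val) pxy.
have := sorted_eq leq_trans anti_leq sx sy pxy.
move/(inj_map val_inj)/eq_in_map=> E; apply/ffunP=> i.
by apply: E; rewrite mem_enum.
Qed.

(** If both selections are onto, [x] and [y] have the same multiset of values, so being monotone
    they coincide. Otherwise the sliding argument applies. *)
Lemma F_usable x h y h' :
  usable x h -> usable y h' -> pull x h = pull y h' -> F h x = F h' y.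
Proof.
move=> xh yh' E.
have [h_onto|] := boolP (onto_slots h); last exact: F_missed_slot.
have [h'_onto|] := boolP (onto_slots h'); last by move=> ?; symmetry; apply: F_missed_slot.
move: xh yh'; rewrite /usable h_onto h'_onto !orbF => mx my.
have xy : x = y.
  apply: monotone_codom_inj => //.
  by rewrite -(permPl (perm_codom_pull x h_onto)) E perm_codom_pull.
by rewrite -xy; apply: F_pull; rewrite E xy.
Qed.

Definition folded_rel a := [exists x, exists h, [&& usable x h, pull x h == a & F h x]].

Lemma folded_relE x h : usable x h -> folded_rel (pull x h) = F h x.
Proof.
move=> xh; apply/existsP/idP=> [[y /existsP[h' /and3P[yh' /eqP E Fy]]]|Fx].
  by rewrite -(F_usable yh' xh E).
by exists x; apply/existsP; exists h; rewrite xh eqxx.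
Qed.

End Folding.

(** * Sorted formulas as boolean functions *)

Section BooleanFunctions.
Variables (Sigma : finType) (k d : nat) (rels : finType) (ar : rels -> nat).
Variables (A : finType) (a0 : A) (at_ : A -> atom Sigma k d ar).
Implicit Types (g : {ffun A -> bool}) (B : {ffun A -> bool} -> bool).

(** The syntax has no constants; the atom [a0] yields one by excluded middle. *)
Definition FTrue := FOr (FAtom (at_ a0)) (FNot (FAtom (at_ a0))).

Definition literal g (a : A) :=
  if g a then FAtom (at_ a) else FNot (FAtom (at_ a)).

Definition minterm g := foldr (@FAnd _ _ _ _ _) FTrue (map (literal g) (enum A)).

(** Any boolean condition on finitely many atoms becomes a formula, so local constraints can be
    stated semantically. *)
Definition dnf B :=
  foldr (@FOr _ _ _ _ _) (FNot FTrue) [seq minterm g | g <- enum {ffun A -> bool} & B g].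

Lemma sorted_dnf B : (forall a, sorted_atom (at_ a)) -> sorted_qf (dnf B).
Proof.
move=> at_sorted; rewrite /dnf; elim: (filter _ _) => [|g s IH] //=.
split=> //; rewrite /minterm; elim: (enum A) => [|a t IHt] //=.
by split=> //; rewrite /literal; case: (g a) => /=.
Qed.

Variables (M : structure Sigma k) (v : 'I_d -> M).
Variable I : forall r : rels, pred ((ar r).-tuple M).

Lemma eval_minterm g :
  eval_qf v I (minterm g) = (g == [ffun a => eval_atom v I (at_ a)]).
Proof.
transitivity (all (fun a => g a == eval_atom v I (at_ a)) (enum A)).
  rewrite /minterm; elim: (enum A) => [|a t IHt] /=; first exact: orbN.
  rewrite IHt /literal; congr (_ && _).
  by case: (g a) => /=; case: eval_atom.
apply/allP/eqP=> [gE | -> a _]; last by rewrite ffunE.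
by apply/ffunP=> a; rewrite ffunE; apply/eqP/gE; rewrite mem_enum.
Qed.

Lemma eval_dnf B : eval_qf v I (dnf B) = B [ffun a => eval_atom v I (at_ a)].
Proof.
set w := [ffun a => _].
transitivity (w \in [seq g <- enum {ffun A -> bool} | B g]).
  rewrite /dnf; elim: (filter _ _) => [|g s IH] /=.
    by rewrite orbN in_nil.
  by rewrite IH eval_minterm inE eq_sym.
by rewrite mem_filter mem_enum andbT.
Qed.

End BooleanFunctions.

(** * Translation of a matrix into a condition on one label *)

Section Translation.
Variables (Sigma : finType) (k d : nat) (rels : finType) (ar : rels -> nat).
Variable M : nat.

(* [None] stands for the order relation. *)
Definition symbol := option (rels + Sigma).

Definition shift := {ffun 'I_d -> 'I_M.+1}.

Definition selector := {ffun 'I_d -> option 'I_d}.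

Fixpoint term_depth (t : term d) : nat := if t is Succ u then (term_depth u).+1 else 0.

Fixpoint term_var (t : term d) : 'I_d :=
  match t with Var i => i | Succ u => term_var u end.

(* In a list of arguments, [None] (also used for padding) denotes the minimum. *)
Definition oterm_depth (o : option (term d)) := if o is Some t then term_depth t else 0.

(** [inord] is faithful only for depths up to [M], which the depth bound will ensure. *)
Definition args_shift (ts : seq (option (term d))) : shift :=
  [ffun i : 'I_d => inord (oterm_depth (nth None ts i))].

Definition args_selector (ts : seq (option (term d))) : selector :=
  [ffun i : 'I_d => omap term_var (nth None ts i)].

Variable truth : symbol -> shift -> selector -> bool.

Definition truth_args s ts := truth s (args_shift ts) (args_selector ts).

(** Equality, minimum and maximum are all expressed through the order. *)
Definition translate_atom (a : atom Sigma k d ar) : bool :=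
  match a with
  | ALetter s t => truth_args (Some (inr s)) (map Some t)
  | ARel r t => truth_args (Some (inl r)) (map Some t)
  | AEq t u =>
      ~~ truth_args None [:: Some t; Some u] && ~~ truth_args None [:: Some u; Some t]
  | ALt t u => truth_args None [:: Some t; Some u]
  | AMin t => ~~ truth_args None [:: None; Some t]
  (* the cyclic successor of the maximum is the minimum *)
  | AMax t => ~~ truth_args None [:: None; Some (Succ t)]
  end.

Fixpoint translate (f : qf_formula Sigma k d ar) : bool :=
  match f with
  | FAtom a => translate_atom a
  | FNot g => ~~ translate g
  | FAnd g h => translate g && translate h
  | FOr g h => translate g || translate h
  end.

End Translation.

Section Depth.
Variables (Sigma : finType) (k d : nat) (rels : finType) (ar : rels -> nat).

Definition atom_depth (a : atom Sigma k d ar) : nat :=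
  match a with
  | ALetter _ t => \max_(u <- t) term_depth u
  | ARel _ t => \max_(u <- t) term_depth u
  | AEq t u | ALt t u => maxn (term_depth t) (term_depth u)
  | AMin t => term_depth t
  | AMax t => (term_depth t).+1
  end.

Fixpoint qf_depth (f : qf_formula Sigma k d ar) : nat :=
  match f with
  | FAtom a => atom_depth a
  | FNot g => qf_depth g
  | FAnd g h | FOr g h => maxn (qf_depth g) (qf_depth h)
  end.

End Depth.

Lemma eq_translate (Sigma : finType) (k d : nat) (rels : finType) (ar : rels -> nat)
    (M : nat) (T T' : symbol Sigma rels -> shift d M -> selector d -> bool)
    (f : qf_formula Sigma k d ar) :
  (forall s m h, T s m h = T' s m h) -> translate T f = translate T' f.
Proof.
move=> TT'; elim: f => [a|g IH|g IHg h IHh|g IHg h IHh] /=; rewrite ?IH ?IHg ?IHh //.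
by case: a => *; rewrite /= /truth_args !TT'.
Qed.

Section TranslationCorrect.
Variables (Sigma : finType) (d n M : nat).
Variables (rels : finType) (ar : rels -> nat) (p : picture Sigma d.-1 n.+1).
Variable I : forall r : rels, pred ((ar r).-tuple 'I_n.+1).
Variable R : symbol Sigma rels -> {ffun 'I_d -> 'I_n.+1} -> bool.

Definition pad (b : seq 'I_n.+1) : {ffun 'I_d -> 'I_n.+1} := [ffun i : 'I_d => nth ord0 b i].

Definition shifted (m : shift d M) (a : {ffun 'I_d -> 'I_n.+1}) : {ffun 'I_d -> 'I_n.+1} :=
  [ffun i => iter (m i) (@ordS n.+1) (a i)].

(** All symbols become [d]-ary by padding with the minimum; only padded tuples are constrained. *)
Definition represents :=
  [/\ forall r (b : (ar r).-tuple 'I_n.+1), R (Some (inl r)) (pad b) = I b,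
      forall s (b : (d.-1).-tuple 'I_n.+1), R (Some (inr s)) (pad b) = (p b == s)
    & forall i j : 'I_n.+1, R None (pad [:: i; j]) = (i < j)].

Lemma eval_term_iter (v : 'I_d -> 'I_n.+1) (t : term d) :
  eval_term (M := coord p) v t = iter (term_depth t) (@ordS n.+1) (v (term_var t)).
Proof. by elim: t => //= t ->. Qed.

Lemma shifted_args (v : 'I_d -> 'I_n.+1) (ts : seq (option (term d))) :
  all (fun o => oterm_depth o <= M) ts ->
  shifted (args_shift M ts) (pull [ffun i => v i] (args_selector ts)) =
  pad (map (fun o => if o is Some t then eval_term (M := coord p) v t else ord0) ts).
Proof.
move=> /all_nthP-/(_ None) depth_le; apply/ffunP=> i; rewrite !ffunE.
have [lt_i|le_i] := ltnP i (size ts); last by rewrite !nth_default ?size_map //= inordK.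
rewrite (nth_map None) // inordK ?ltnS ?depth_le //.
by case: (nth None ts i) => [t|] //=; rewrite eval_term_iter ffunE.
Qed.

Lemma translate_correct (v : 'I_d -> 'I_n.+1) (f : qf_formula Sigma d.-1 d ar) :
  represents -> qf_depth f <= M ->
  eval_qf (M := coord p) v I f =
  translate (fun s m h => R s (shifted m (pull [ffun i => v i] h))) f.
Proof.
move=> [R_rel R_letter R_lt].
elim: f => [a|g IH|g IHg h IHh|g IHg h IHh] /=; rewrite ?geq_max.
- have seq_depth (t : seq (term d)) : \max_(u <- t) term_depth u <= M ->
      all (fun o => oterm_depth o <= M) (map Some t).
    by elim: t => //= u t IH; rewrite big_cons geq_max => /andP[-> /IH].
  case: a => [s t|r t|t u|t u|t|t]; rewrite /= /truth_args ?geq_max.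
  + move=> /seq_depth t_le; rewrite shifted_args // -map_comp.
    by rewrite -[map _ _]/(tval (map_tuple (eval_term (M := coord p) v) t)) R_letter.
  + move=> /seq_depth t_le; rewrite shifted_args // -map_comp.
    by rewrite -[map _ _]/(tval (map_tuple (eval_term (M := coord p) v) t)) R_rel.
  + case/andP=> t_le u_le; rewrite !shifted_args /= ?t_le ?u_le // !R_lt.
    by rewrite -val_eqE eqn_leq -!leqNgt andbC.
  + by case/andP=> t_le u_le; rewrite !shifted_args /= ?t_le ?u_le // !R_lt.
  + by move=> t_le; rewrite !shifted_args /= ?t_le // !R_lt lt0n negbK.
  + move=> t_le; rewrite !shifted_args /= ?t_le // !R_lt lt0n negbK.
    rewrite -[RHS]/(val (ordS _) == val (ord0 : 'I_n.+1)) val_eqE.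
    by rewrite ordS_eq0.
- by move=> /IH ->.
- by case/andP=> /IHg -> /IHh ->.
- by case/andP=> /IHg -> /IHh ->.
Qed.

End TranslationCorrect.

(** * Local constraints *)

Section LocalConstraints.
Variables (Sigma : finType) (d : nat) (rels : finType) (ar : rels -> nat).
Variables (theta : qf_formula Sigma d.-1 d ar) (M : nat).

(* The label [(s, m, h)] holds at [x] when the relation [s] holds of the tuple
   whose [i]-th entry is the [m i]-th successor of the coordinate [h i] of [x]. *)
Definition label := (symbol Sigma rels * shift d M * selector d)%type.

Definition shift0 : shift d M := [ffun=> ord0].

Definition shiftS (m : shift d M) (i : 'I_d) : shift d M :=
  [ffun l => if l == i then inord (m l).+1 else m l].

Definition lt_selector (i j : 'I_d) : selector d :=
  [ffun l : 'I_d => nth None [:: Some i; Some j] l].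

Definition letter_selector : selector d :=
  [ffun l : 'I_d => if l < d.-1 then Some l else None].

Definition unset (h : selector d) (i : 'I_d) : selector d :=
  [ffun l => if l == i then None else h l].

Definition rename (s : {ffun 'I_d -> 'I_d}) (h : selector d) : selector d :=
  [ffun i => omap s (h i)].

Section Clauses.
(** [cur] gives the labels at a point, [nxt j] those at its neighbour in direction [j]; [mn] and
    [mx] test its coordinates, and [lt] its letter. Plain booleans let the clauses serve both for
    labellings and for truth values of atoms. *)
Variables (cur : label -> bool) (nxt : 'I_d -> label -> bool).
Variables (mn mx : 'I_d -> bool) (lt : Sigma -> bool).

Definition cur_lt i j := cur (None, shift0, lt_selector i j).

Definition same_slot (o o' : option 'I_d) : bool :=
  match o, o' with
  | Some i, Some j => ~~ cur_lt i j && ~~ cur_lt j i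
  | Some i, None | None, Some i => mn i
  | None, None => true
  end.

(** A recursive definition of the order: nothing is below the minimum, and [x i < x j + 1] iff not
    [x j < x i]. *)
Definition lt_clause := [forall i : 'I_d, forall j : 'I_d,
  if i == j then ~~ cur_lt i j else
  (mn j ==> ~~ cur_lt i j) &&
  (~~ mx j ==> (nxt j (None, shift0, lt_selector i j) == ~~ cur_lt j i))].

Definition pull_clause := [forall s, forall m, forall h : selector d, forall h' : selector d,
  [forall i, same_slot (h i) (h' i)] ==> (cur (s, m, h) == cur (s, m, h'))].

Definition step_clause := [forall s, forall m, forall h : selector d, forall j : 'I_d,
  (Some j \notin codom h) ==> (nxt j (s, m, h) == cur (s, m, h))].

(** A successor on argument [i] is traded for a step of the coordinate it reads, or for the minimum
    if that step wraps. No other argument may read [j], as it would move too. *)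
Definition shift_clause :=
  [forall s, forall m : shift d M, forall h : selector d, forall i : 'I_d, forall j : 'I_d,
  [&& m i < M, h i == Some j & [forall l, (h l == Some j) ==> (l == i)]] ==>
  (cur (s, shiftS m i, h) == if mx j then cur (s, m, unset h i) else nxt j (s, m, h))].

Definition letter_clause :=
  [forall s : Sigma, cur (Some (inr s), shift0, letter_selector) == lt s].

(** Every assignment is [x o s] for some monotone [x], so letting [s] range over all maps makes
    monotone points suffice. *)
Definition matrix_clause := [forall s : {ffun 'I_d -> 'I_d},
  translate (fun r m h => cur (r, m, rename s h)) theta].

Definition locally_ok :=
  [&& lt_clause, pull_clause, step_clause, shift_clause & letter_clause && matrix_clause].

End Clauses.

Lemma eq_locally_ok (cur cur' : label -> bool) nxt nxt' mn mn' mx mx' lt lt' :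
  cur =1 cur' -> nxt =2 nxt' -> mn =1 mn' -> mx =1 mx' -> lt =1 lt' ->
  locally_ok cur nxt mn mx lt = locally_ok cur' nxt' mn' mx' lt'.
Proof.
move=> curE nxtE mnE mxE ltE.
congr [&& _, _, _, _ & _ && _].
- by do 2!apply: eq_forallb => ?; rewrite /cur_lt !curE nxtE mnE mxE.
- do 4!apply: eq_forallb => ?; rewrite !curE; congr (_ ==> _).
  apply: eq_forallb => i; rewrite /same_slot /cur_lt.
  by do 2!case: (_ i) => [?|]; rewrite ?curE ?mnE.
- by do 4!apply: eq_forallb => ?; rewrite curE nxtE.
- by do 5!apply: eq_forallb => ?; rewrite !curE nxtE mxE.
- by apply: eq_forallb => ?; rewrite curE ltE.
- by apply: eq_forallb => ?; apply: eq_translate => ? ? ?; rewrite curE.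
Qed.

Section Labelling.
Variables (n : nat) (p : picture Sigma d.-1 n.+1).
Implicit Types (x y a : {ffun 'I_d -> 'I_n.+1}) (h : selector d) (m : shift d M).

Definition prefix_tuple x : (d.-1).-tuple 'I_n.+1 :=
  [tuple x (widen_ord (leq_pred d) i) | i < d.-1].

Definition labelling_ok (L : label -> {ffun 'I_d -> 'I_n.+1} -> bool) x :=
  locally_ok (L^~ x) (fun j g => L g (step x j)) (fun j => x j == 0 :> nat)
    (fun j => x j == n :> nat) (fun s => p (prefix_tuple x) == s).

Lemma pull_lt x i j : pull x (lt_selector i j) = pad d [:: x i; x j].
Proof. by apply/ffunP=> l; rewrite !ffunE; case: l => [[|[|l]] l_lt] //=; rewrite !nth_nil. Qed.

Lemma pull_letter x : pull x letter_selector = pad d (prefix_tuple x).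
Proof.
apply/ffunP=> l; rewrite !ffunE; case: ifP => l_lt.
  by rewrite -(tnth_nth _ _ (Ordinal l_lt)) tnth_mktuple /=; congr (x _); apply: val_inj.
by rewrite nth_default // size_tuple leqNgt l_lt.
Qed.

Lemma shifted0 a : shifted shift0 a = a.
Proof. by apply/ffunP=> i; rewrite !ffunE. Qed.

Lemma shifted_shiftS m i a : m i < M -> shifted (shiftS m i) a = shifted m (step a i).
Proof.
move=> mi; apply/ffunP=> l; rewrite !ffunE; case: eqP => [->|] //.
by rewrite inordK // iterSr.
Qed.

Lemma pull_rename x s h : pull x (rename s h) = pull [ffun i => x (s i)] h.
Proof. by apply/ffunP=> l; rewrite !ffunE; case: (h l) => //= j; rewrite ffunE. Qed.

Lemma pull_step x h i j : h i = Some j -> (forall l, h l = Some j -> l = i) ->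
  pull (step x j) h = step (pull x h) i.
Proof.
move=> hi hj; apply/ffunP=> l; rewrite !ffunE hi; case: (eqVneq l i) => [->|li].
  by rewrite hi /= ffunE eqxx.
case E: (h l) => [q|] //=; rewrite ffunE; case: eqP => // qj.
by case/eqP: li; apply: hj; rewrite E qj.
Qed.

Lemma pull_unset x h i j : h i = Some j -> x j = n :> nat ->
  pull x (unset h i) = step (pull x h) i.
Proof.
move=> hi xj; apply/ffunP=> l; rewrite !ffunE hi; case: (eqVneq l i) => //= _.
by rewrite ordS_max.
Qed.

(** * From a model to a labelling *)

Section Honest.
Variable R : symbol Sigma rels -> {ffun 'I_d -> 'I_n.+1} -> bool.
Variable I : forall r : rels, pred ((ar r).-tuple 'I_n.+1).
Hypothesis R_repr : represents p I R.
Hypothesis depth_le : qf_depth theta <= M.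
Hypothesis I_model : forall v : 'I_d -> 'I_n.+1, eval_qf (M := coord p) v I theta.

Definition honest (g : label) x := R g.1.1 (shifted g.1.2 (pull x g.2)).

Lemma honest_ok x : labelling_ok honest x.
Proof.
have [R_rel R_letter R_lt] := R_repr.
have lt_ij y i j : honest (None, shift0, lt_selector i j) y = (y i < y j).
  by rewrite /honest /= shifted0 pull_lt R_lt.
apply/and5P; split; last apply/andP; last split.
- apply/forallP=> i; apply/forallP=> j; rewrite /cur_lt !lt_ij.
  case: (eqVneq i j) => [->|ij]; first by rewrite ltnn.
  apply/andP; split; first by apply/implyP=> /eqP->.
  apply/implyP=> xj; rewrite !ffunE eqxx (negPf ij) -leqNgt.
  by rewrite -[X in _ < X]/(nat_of_ord (ordS (x j))) ordS_small // ltnS.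
- apply/forallP=> s; apply/forallP=> m; apply/forallP=> h; apply/forallP=> h'.
  apply/implyP=> /forallP same; rewrite /honest /=; apply/eqP; congr (R s (shifted m _)).
  apply/ffunP=> i; rewrite !ffunE; move: (same i); rewrite /same_slot /cur_lt.
  case: (h i) (h' i) => [j|] [l|] //=; rewrite ?lt_ij.
  + by rewrite -!leqNgt -eqn_leq eq_sym => /eqP ?; apply: val_inj.
  + by move=> /eqP ?; apply: val_inj.
  + by move=> /eqP ?; apply: val_inj.
- apply/forallP=> s; apply/forallP=> m; apply/forallP=> h; apply/forallP=> j.
  by apply/implyP=> hj; rewrite /honest /= pull_set_at.
- apply/forallP=> s; apply/forallP=> m; apply/forallP=> h.
  apply/forallP=> i; apply/forallP=> j; apply/implyP=> /and3P[mi /eqP hi /forallP hj].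
  rewrite /honest /= shifted_shiftS //; case: (eqVneq (x j : nat) n) => xj.
    by rewrite (pull_unset hi xj).
  rewrite (pull_step x hi) // => l hl.
  by apply/eqP/(implyP (hj l))/eqP.
- apply/forallP=> s.
  by rewrite /honest /= shifted0 pull_letter R_letter.
- apply/forallP=> s; rewrite -(eq_translate (T := fun r m h =>
    R r (shifted m (pull [ffun i => x (s i)] h)))); last first.
    by move=> r m h; rewrite /honest /= pull_rename.
  by rewrite -(translate_correct (fun i => x (s i)) R_repr).
Qed.

End Honest.

(** * From a labelling to a model *)

Section Decoding.
Hypothesis d_gt1 : 1 < d.
Hypothesis depth_le : qf_depth theta <= M.
Variable L : label -> {ffun 'I_d -> 'I_n.+1} -> bool.
Hypothesis L_ok : forall x, labelling_ok L x.

(** Induction on [x i + x j]: stepping back in direction [j] exchanges the two indices and lowers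
    the sum by one. *)
Lemma label_lt x i j : L (None, shift0, lt_selector i j) x = (x i < x j).
Proof.
have L_lt y (q l : 'I_d) : if q == l then ~~ L (None, shift0, lt_selector q l) y else
  ((y l == 0 :> nat) ==> ~~ L (None, shift0, lt_selector q l) y) &&
  ((y l != n :> nat) ==> (L (None, shift0, lt_selector q l) (step y l) ==
                        ~~ L (None, shift0, lt_selector l q) y)).
  by have /and5P[/forallP/(_ q)/forallP/(_ l)] := L_ok y.
have [N] := ubnP (x i + x j); elim: N => // N IH in x i j *; rewrite ltnS => xN.
have := L_lt x i j; case: (eqVneq i j) => [-> /negbTE->|ij]; first by rewrite ltnn.
case/andP=> xj0 _; case E: (x j : nat) => [|c].
  by rewrite ltn0; apply/negbTE/(implyP xj0); rewrite E.
have c_lt : c < n.+1 by have := ltn_ord (x j); lia.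
pose y := set_at x j (Ordinal c_lt).
have yj : y j = c :> nat by rewrite ffunE eqxx.
have yi : y i = x i by rewrite ffunE (negPf ij).
have yj_n : y j != n :> nat by have := ltn_ord (x j); lia.
have xy : x = step y j.
  apply/ffunP=> l; rewrite ffunE; have [->|lj] := eqVneq l j.
    by apply: ord_inj; rewrite ordS_small // yj.
  by rewrite ffunE (negPf lj).
have := L_lt y i j; rewrite (negPf ij) yj_n /= -xy => /andP[_ /eqP->].
by rewrite IH yi yj ?ltnS -?leqNgt //; lia.
Qed.

(** As the order labels are correct, [same_slot] tests true equality of values. *)
Lemma label_pull s m x h h' : pull x h = pull x h' -> L (s, m, h) x = L (s, m, h') x.
Proof.
move=> E; have /and5P[_ /forallP/(_ s)/forallP/(_ m)/forallP/(_ h)/forallP/(_ h') + _ _ _]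
  := L_ok x.
move/implyP=> same; apply/eqP/same/forallP=> i.
have := congr1 (fun a : {ffun 'I_d -> 'I_n.+1} => a i) E; rewrite !ffunE /same_slot /cur_lt.
case: (h i) (h' i) => [j|] [l|] //=; rewrite ?label_lt.
- by move=> ->; rewrite ltnn.
- by move=> ->.
- by move=> <-.
Qed.

Lemma label_step s m x h j :
  Some j \notin codom h -> L (s, m, h) (step x j) = L (s, m, h) x.
Proof.
move=> hj; have /and5P[_ _ /forallP/(_ s)/forallP/(_ m)/forallP/(_ h)/forallP/(_ j) + _ _]
  := L_ok x.
by rewrite hj => /eqP.
Qed.

Definition label_rel s m := folded_rel (fun h x => L (s, m, h) x).

Lemma label_relE s m x h : usable x h -> label_rel s m (pull x h) = L (s, m, h) x.
Proof.
by apply: (folded_relE (F := fun h x => L (s, m, h) x)); [apply: label_pull | apply: label_step].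
Qed.

Lemma usable_monotone x h : monotone x -> usable x h.
Proof. by rewrite /usable => ->. Qed.

Lemma sorted_pull x (s : {ffun 'I_d -> 'I_d}) :
  [ffun i => x (s i)] = pull x [ffun i => Some (s i)].
Proof. by apply/ffunP=> i; rewrite !ffunE. Qed.

(** [sort_point] gives a monotone [x] that stays monotone after the step, with an injective
    selection. If the step wraps, [unset] expresses it at [x] itself. *)
Lemma label_rel_shiftS s m i a : m i < M ->
  label_rel s (shiftS m i) a = label_rel s m (step a i).
Proof.
move=> mi; have [x [f [f_inj -> x_mono step_mono]]] := sort_point a i.
rewrite [in LHS]sorted_pull label_relE ?usable_monotone //.
set h := [ffun l => _]; have hi : h i = Some (f i) by rewrite ffunE.
have hj l : h l = Some (f i) -> l = i by rewrite ffunE => -[/f_inj].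
have /and5P[_ _ _ /forallP/(_ s)/forallP/(_ m)/forallP/(_ h)/forallP/(_ i)/forallP/(_ (f i))
  + _] := L_ok x.
rewrite mi hi eqxx /=.
have -> /= : [forall l, (h l == Some (f i)) ==> (l == i)].
  by apply/forallP=> l; apply/implyP=> /eqP/hj ->.
move=> /eqP ->; rewrite sorted_pull -/h.
have [xi|xi] := eqVneq (x (f i) : nat) n.
  by rewrite -(pull_unset hi xi) label_relE ?usable_monotone.
rewrite -(pull_step x hi hj) label_relE // usable_monotone //.
by apply: step_mono; rewrite ffunE.
Qed.

(** Successors are removed one at a time, by induction on their total number. *)
Lemma label_rel_shifted s m a : label_rel s m a = label_rel s shift0 (shifted m a).
Proof.
have [N] := ubnP (\sum_i m i); elim: N => // N IH in m a *; rewrite ltnS => mN.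
have [/existsP[i mi]|] := boolP [exists i, 0 < m i]; last first.
  rewrite negb_exists => /forallP m0; have -> : m = shift0.
    by apply/ffunP=> i; apply: val_inj; move: (m0 i); rewrite ffunE lt0n negbK => /eqP.
  by rewrite shifted0.
pose m' : shift d M := [ffun l => if l == i then inord (m l).-1 else m l].
have m'i : m' i = (m i).-1 :> nat.
  by rewrite ffunE eqxx inordK //; have := ltn_ord (m i); lia.
have m'i_lt : m' i < M by rewrite m'i; have := ltn_ord (m i); lia.
have -> : m = shiftS m' i.
  apply/ffunP=> l; rewrite ffunE; have [->|li] := eqVneq l i.
    by rewrite m'i prednK // inord_val.
  by rewrite ffunE (negPf li).
rewrite label_rel_shiftS // shifted_shiftS //; apply: IH; apply: leq_trans mN.
rewrite (bigD1 i) //= [X in _ < X](bigD1 i) //= m'i.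
rewrite -addSn prednK // leq_add2l; apply: leq_sum => l li.
by rewrite ffunE (negPf li).
Qed.

(** Pictures have dimension [d - 1], so the last coordinate is free and letters can be read at
    points that are not monotone. *)
Lemma letter_selector_missed : ~~ onto_slots letter_selector.
Proof.
have dn : d.-1 < d by rewrite prednK //; lia.
apply/missed_slotP; exists (Ordinal dn); apply/codomP=> -[l]; rewrite ffunE.
by case: ifP => // l_lt [] E; rewrite -E ltnn in l_lt.
Qed.

Definition label_interp (r : rels) : pred ((ar r).-tuple 'I_n.+1) :=
  fun b => label_rel (Some (inl r)) shift0 (pad d b).

Lemma label_represents : represents p label_interp (fun s => label_rel s shift0).
Proof.
split=> // [s b|u w].
- pose x := pad d b; have -> : pad d b = pull x letter_selector.
    rewrite pull_letter; apply/ffunP=> l; rewrite !ffunE.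
    have [l_lt|l_ge] := ltnP l d.-1; last by rewrite !nth_default ?size_tuple.
    by rewrite -[RHS](tnth_nth _ _ (Ordinal l_lt)) tnth_mktuple ffunE.
  rewrite label_relE; last by rewrite /usable letter_selector_missed orbT.
  have /and5P[_ _ _ _ /andP[/forallP/(_ s)/eqP-> _]] := L_ok x.
  congr (p _ == s); apply: eq_from_tnth => i.
  by rewrite tnth_mktuple ffunE (tnth_nth ord0).
(* The pair [u], [w] is read off a monotone point, where [label_relE] applies. *)
have [x [f [_ xE x_mono _]]] := sort_point (pad d [:: u; w]) (Ordinal d_gt1).
have d_gt0 : 0 < d by lia.
have xu : x (f (Ordinal d_gt0)) = u.
  by have /ffunP/(_ (Ordinal d_gt0)) := xE; rewrite !ffunE.
have xw : x (f (Ordinal d_gt1)) = w.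
  by have /ffunP/(_ (Ordinal d_gt1)) := xE; rewrite !ffunE.
rewrite -[in LHS]xu -[in LHS]xw -pull_lt label_relE ?usable_monotone //.
by rewrite label_lt xu xw.
Qed.

(** With [v = x o f] and [x] monotone, the matrix clause at [x] for [f] is [theta] under [v]. *)
Lemma label_model (v : 'I_d -> 'I_n.+1) : eval_qf (M := coord p) v label_interp theta.
Proof.
rewrite (translate_correct v label_represents depth_le).
have d_gt0 : 0 < d by lia.
have [x [f [_ vE x_mono _]]] := sort_point [ffun i => v i] (Ordinal d_gt0).
have /and5P[_ _ _ _ /andP[_ /forallP/(_ f)]] := L_ok x.
rewrite (eq_translate (T' := fun s m h =>
  label_rel s shift0 (shifted m (pull [ffun i => v i] h)))) // => s m h.
by rewrite vE -pull_rename -label_rel_shifted label_relE ?usable_monotone.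
Qed.

End Decoding.
End Labelling.
End LocalConstraints.

(** * The local constraints as a sorted sentence *)

Section SortedSentence.
Variables (Sigma : finType) (d : nat) (rels : finType) (ar : rels -> nat).
Variables (theta : qf_formula Sigma d.-1 d ar) (M : nat) (i0 : 'I_d).

Local Notation label := (label Sigma d rels M).

(* The minimum and maximum tests are tagged by [true] and [false]. *)
Definition view := ((label + 'I_d * label) + ('I_d * bool + Sigma))%type.

Definition view_arity (g : label) : nat := d.

Definition succ_tuple (i : 'I_d) : d.-tuple (term d) :=
  [tuple if j == i then Succ (Var j) else Var j | j < d].

Lemma size_letter_args : size (take d.-1 (xvars d)) == d.-1.
Proof. by rewrite size_take_min size_map size_enum_ord (minn_idPl (leq_pred d)). Qed.

Definition view_atom (a : view) : atom Sigma d.-1 d view_arity :=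
  match a with
  | inl (inl g) => ARel Sigma d.-1 (ar := view_arity) (r := g) [tuple Var j | j < d]
  | inl (inr (i, g)) => ARel Sigma d.-1 (ar := view_arity) (r := g) (succ_tuple i)
  | inr (inl (i, b)) => if b then AMin _ _ _ (Var i) else AMax _ _ _ (Var i)
  | inr (inr s) => ALetter _ s (Tuple size_letter_args)
  end.

Lemma sorted_view_atom a : sorted_atom (view_atom a).
Proof.
case: a => [[g|[i g]]|[[i []]|s]] /=; [by left | | | |by []].
- by right; exists i.
- by exists i.
- by exists i.
Qed.

Definition view_ok (w : {ffun view -> bool}) : bool :=
  locally_ok theta (fun g => w (inl (inl g))) (fun i g => w (inl (inr (i, g))))
    (fun i => w (inr (inl (i, true)))) (fun i => w (inr (inl (i, false))))
    (fun s => w (inr (inr s))).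

(** One [d]-ary relation symbol per label; [i0] supplies the atom from which constants are
    formed. *)
Definition sorted_sentence : eso_sentence Sigma d.-1 d :=
  EsoSentence (dnf (inr (inl (i0, true))) view_atom view_ok).

Lemma in_ESO_sorted_sentence : in_ESO_sorted sorted_sentence.
Proof. by split=> //; apply: sorted_dnf; apply: sorted_view_atom. Qed.

Variables (n : nat) (p : picture Sigma d.-1 n.+1).
Variable I : forall g : label, pred (d.-tuple 'I_n.+1).

Lemma eval_sorted_sentence (v : 'I_d -> 'I_n.+1) :
  eval_qf (M := coord p) (ar := view_arity) v I (matrix sorted_sentence) =
  labelling_ok theta p (fun g x => I g [tuple x i | i < d]) [ffun i => v i].
Proof.
rewrite /= eval_dnf; apply: eq_locally_ok => [g|i g|i|i|s]; rewrite ffunE /=.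
- by congr (I g); apply: eq_from_tnth => j; rewrite tnth_map !tnth_mktuple /= ffunE.
- congr (I g); apply: eq_from_tnth => j.
  by rewrite tnth_map !tnth_mktuple !ffunE; case: eqP => [->|].
- by rewrite ffunE.
- by rewrite ffunE.
- congr (p _ == s); apply: eq_from_tnth => j.
  rewrite tnth_mktuple ffunE tnth_map (tnth_nth (Var (widen_ord (leq_pred d) j))) /=.
  rewrite nth_take // (nth_map (widen_ord (leq_pred d) j)) ?size_enum_ord /=; last first.
    exact: leq_trans (ltn_ord j) (leq_pred d).
  by congr v; apply: val_inj; rewrite /= nth_enum_ord //; apply: leq_trans (ltn_ord j) (leq_pred d).
Qed.

End SortedSentence.

(** * Equality of the two logics *)

Lemma interp_represents (Sigma : finType) (d n : nat) (rels : finType) (ar : rels -> nat)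
    (p : picture Sigma d.-1 n.+1) (I : forall r : rels, pred ((ar r).-tuple 'I_n.+1)) :
  1 < d -> (forall r, ar r <= d) ->
  exists R : symbol Sigma rels -> {ffun 'I_d -> 'I_n.+1} -> bool, represents p I R.
Proof.
move=> d_gt1 ar_le; have d_gt0 : 0 < d by lia.
(* Each relation is extended to [d] arguments by reading only the first ones. *)
exists (fun (s : symbol Sigma rels) (a : {ffun 'I_d -> 'I_n.+1}) => match s with
  | Some (inl r) => I r [tuple a (widen_ord (ar_le r) i) | i < ar r]
  | Some (inr s) => p (prefix_tuple a) == s
  | None => a (Ordinal d_gt0) < a (Ordinal d_gt1)
  end); split=> [r b|s b|i j].
- by congr (I r); apply: eq_from_tnth => i; rewrite tnth_mktuple ffunE (tnth_nth ord0).
- by congr (p _ == s); apply: eq_from_tnth => i; rewrite tnth_mktuple ffunE (tnth_nth ord0).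
- by rewrite !ffunE.
Qed.

Theorem theorem5 (d : nat) (d_gt1 : 1 < d) (Sigma : finType) :
  (forall Phi : eso_sentence Sigma d.-1 d, in_ESO d Phi ->
     exists Phi' : eso_sentence Sigma d.-1 d, in_ESO_sorted Phi' /\
       forall (n : nat), 0 < n -> forall p : picture Sigma d.-1 n,
         models (coord p) Phi <-> models (coord p) Phi')
  /\
  (forall Phi : eso_sentence Sigma d.-1 d, in_ESO_sorted Phi -> in_ESO d Phi).
Proof.
split=> [[rels ar theta] ar_le | Phi [arE _] r]; last by rewrite arE.
exists (sorted_sentence theta (qf_depth theta) (Ordinal d_gt1)).
split=> [|[//|n] _ p]; first exact: in_ESO_sorted_sentence.
split=> [[I I_model] | [I I_model]].
- have [R R_repr] := interp_represents (rels := rels) (ar := ar) p I d_gt1 ar_le.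
  pose J (g : label Sigma d rels (qf_depth theta)) (b : d.-tuple 'I_n.+1) :=
    honest R g [ffun i => tnth b i].
  exists J => v; rewrite (eval_sorted_sentence theta _ p J).
  have tupleK (x : {ffun 'I_d -> 'I_n.+1}) : [ffun i => tnth [tuple x i | i < d] i] = x.
    by apply/ffunP=> i; rewrite ffunE tnth_mktuple.
  apply: etrans (honest_ok R_repr (leqnn _) I_model [ffun i => v i]).
  by apply: eq_locally_ok => [g|i g|i|i|s] //; rewrite /J tupleK.
- pose L g (x : {ffun 'I_d -> 'I_n.+1}) := I g [tuple x i | i < d].
  have L_ok x : labelling_ok theta p L x.
    have -> : x = [ffun i => x i] by apply/ffunP=> i; rewrite ffunE.
    by rewrite -(eval_sorted_sentence theta (Ordinal d_gt1) p I); apply: I_model.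
  exists (label_interp L) => v; exact: (label_model d_gt1 (leqnn _) L_ok).
Qed.
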